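(* Let $G$ be a connected real Lie group with identity $e$ and Lie algebra $\mathfrak{g}$ of right invariant vector fields. Let $\mathcal{X}_0=\mathcal{X},\mathcal{X}_1,\ldots,\mathcal{X}_m$ be linear vector fields on $G$ with $[\mathcal{X}_i,\mathcal{X}_j]=0$ for all $i,j=0,\ldots,m$, whose associated derivations are inner, and let $X_0=X,X_1,\ldots,X_m\in\mathfrak{g}$ be such that $\mathcal{X}_i=X_i+dI X_i$ for $i=0,\ldots,m$. Let $Y,Y_1,\ldots,Y_m\in\mathfrak{g}$, and let $u=(u_1,\ldots,u_m)$ be a constant admissible control, with $u_0=1$. Then the solution $\phi_t(e,u)$, starting at $e$, of the affine system $$\frac{dg}{dt}=(\mathcal{X}+Y)(g)+\sum_{j=1}^{m}u_j(\mathcal{X}_j+Y_j)(g)$$ is $$\phi_t(e,u)=\exp\left(tX+tY+\sum_{j=1}^m u_jt(X_j+Y_j)\right)\exp\left(-t\sum_{i=0}^{m}u_iX_i\right).$$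
   Context: A vector field on $G$ is called linear if its flow is a one-parameter group of automorphisms of $G$. A linear vector field $\mathcal{X}_i$ has associated derivation $\mathcal{D}_i=-\mathrm{ad}(\mathcal{X}_i)$ of $\mathfrak{g}$, i.e. $\mathcal{D}_i(Z)=-[\mathcal{X}_i,Z]$. Let $I:G\to G$, $I(g)=g^{-1}$; $dI X_i$ denotes the left invariant vector field $I_*X_i$ induced by $X_i$. When $\mathcal{D}_i$ is inner there is $X_i\in\mathfrak{g}$ with $\mathcal{X}_i=X_i+dI X_i$; equivalently the flow of $\mathcal{X}_i$ is $\varphi^i_t(g)=\exp(tX_i)\,g\,\exp(-tX_i)$. *)

(* Defs.v *)
From HB Require Import structures.
From mathcomp Require Import all_boot all_order all_algebra.
From mathcomp Require Import all_classical all_reals all_analysis.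

Set Implicit Arguments.
Unset Strict Implicit.
Unset Printing Implicit Defensive.

Import Order.TTheory GRing.Theory Num.Theory.
Import numFieldNormedType.Exports.

Local Open Scope classical_set_scope.
Local Open Scope ring_scope.

Section Smooth.
Context {R : realType}.

(* Only used for finite-dimensional V, where having all directional
   derivatives of class C^k is the same as having a C^k differential. *)
Fixpoint Ck_on {V W : normedModType R} (k : nat) (U : set V) (f : V -> W) :
    Prop :=
  match k with
  | 0 => forall x, U x -> {for x, continuous f}
  | k'.+1 => (forall x, U x -> differentiable f x) /\
             (forall v : V, Ck_on k' U (fun x => 'D_v f x))
  end.

Definition smooth_on {V W : normedModType R} (U : set V) (f : V -> W) : Prop :=
  forall k, Ck_on k U f.

Definition smooth_near {V W : normedModType R} (x : V) (f : V -> W) : Prop :=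
  exists2 U : set V, open_nbhs x U & smooth_on U f.

End Smooth.

(* Values of [chart_map] outside [chart_dom], and of [chart_inv] outside
   [chart_img], are irrelevant. *)
Record chart (R : realType) (n : nat) (G : topologicalType) := Chart {
  chart_dom : set G ;
  chart_img : set 'rV[R]_n ;
  chart_map : G -> 'rV[R]_n ;
  chart_inv : 'rV[R]_n -> G ;
  chart_dom_open : open chart_dom ;
  chart_img_open : open chart_img ;
  chart_map_img : forall p, chart_dom p -> chart_img (chart_map p) ;
  chart_inv_dom : forall x, chart_img x -> chart_dom (chart_inv x) ;
  chart_mapK : forall p, chart_dom p -> chart_inv (chart_map p) = p ;
  chart_invK : forall x, chart_img x -> chart_map (chart_inv x) = x ;
  chart_map_continuous :
    forall p, chart_dom p -> {for p, continuous chart_map} ;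
  chart_inv_continuous :
    forall x, chart_img x -> {for x, continuous chart_inv} }.

Arguments chart_dom {R n G} c.
Arguments chart_img {R n G} c.
Arguments chart_map {R n G} c.
Arguments chart_inv {R n G} c.

HB.mixin Record isLieGroup (R : realType) (n : nat) (G : Type)
    of Group G & Topological G := {
  lie_hausdorff : hausdorff_space G ;
  lie_second_countable : @second_countable G ;
  atlas : set (chart R n G) ;
  atlas_cover : forall p : G, exists2 c, atlas c & chart_dom c p ;
  atlas_compatible : forall c d, atlas c -> atlas d ->
    smooth_on [set x | chart_img c x /\ chart_dom d (chart_inv c x)]
      (chart_map d \o chart_inv c) ;
  lie_mul_continuous : continuous (fun z : G * G => (z.1 * z.2)%g) ;
  lie_mul_smooth : forall (x y : G) a b c, atlas a -> atlas b -> atlas c ->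
    chart_dom a x -> chart_dom b y -> chart_dom c (x * y)%g ->
    smooth_near (chart_map a x, chart_map b y)
      (fun z : 'rV[R]_n * 'rV[R]_n =>
         chart_map c (chart_inv a z.1 * chart_inv b z.2)%g) ;
  lie_inv_continuous : continuous (fun x : G => x^-1%g) ;
  lie_inv_smooth : forall (x : G) a b, atlas a -> atlas b ->
    chart_dom a x -> chart_dom b x^-1%g ->
    smooth_near (chart_map a x)
      (fun z : 'rV[R]_n => chart_map b (chart_inv a z)^-1%g) }.

#[short(type="lieGroupType")]
HB.structure Definition LieGroup (R : realType) (n : nat) :=
  {G of isLieGroup R n G & Group G & Topological G}.

Section VectorFields.
Context {R : realType} {n : nat} {G : lieGroupType R n}.
Implicit Types (f : G -> R) (p g h : G) (c d : chart R n G).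

Definition smooth_at f p : Prop :=
  forall c, atlas c -> chart_dom c p ->
    smooth_near (chart_map c p) (f \o chart_inv c).

Definition smooth_map (F : G -> G) : Prop :=
  continuous F /\
  forall p c d, atlas c -> atlas d -> chart_dom c p -> chart_dom d (F p) ->
    smooth_near (chart_map c p) (chart_map d \o F \o chart_inv c).

(* Vector fields act on functions as first-order differential operators. The
   value [X f p] is only meaningful when [f] is smooth near [p], so equality of
   vector fields is [vf_eq] rather than Leibniz equality. *)
Definition vfield := (G -> R) -> (G -> R).
Implicit Types X Y Z : (G -> R) -> (G -> R).

Definition vf_eq X Y : Prop := forall f p, smooth_at f p -> X f p = Y f p.

(* In each chart, X = \sum_i a_i d/dx_i with smooth coefficients a. *)
Definition vector_field X : Prop :=
  forall c, atlas c ->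
    exists2 a : 'rV[R]_n -> 'rV[R]_n, smooth_on (chart_img c) a &
      forall f p, chart_dom c p -> smooth_at f p ->
        X f p = 'D_(a (chart_map c p)) (f \o chart_inv c) (chart_map c p).

Definition bracket X Y : (G -> R) -> (G -> R) :=
  fun f => X (Y f) - Y (X f).

(* Invariance under the right translations g |-> g * h. *)
Definition right_invariant X : Prop :=
  forall h p f, smooth_at f (p * h)%g ->
    X (fun g => f (g * h)%g) p = X f (p * h)%g.

Definition lie_algebra X : Prop := vector_field X /\ right_invariant X.

(* The pushforward I_* X by I g = g^-1. *)
Definition dI X : (G -> R) -> (G -> R) :=
  fun f p => X (fun g => f g^-1%g) p^-1%g.

(* J is meant to be open. *)
Definition integral_curve_on (J : set R) X (gam : R -> G) : Prop :=
  forall t, J t -> {for t, continuous gam} /\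
    forall f, smooth_at f (gam t) ->
      is_derive t (1 : R) (f \o gam) (X f (gam t)).

(* [phi] is the solution, defined for all times, of dg/dt = X(g), g(0) = g0;
   every solution on an open interval around 0 is a restriction of it. *)
Definition is_the_solution X g0 (phi : R -> G) : Prop :=
  [/\ phi 0 = g0,
      integral_curve_on setT X phi &
      forall (a b : R) (psi : R -> G), a < 0 -> 0 < b ->
        psi 0 = g0 -> integral_curve_on `]a, b[ X psi ->
        forall t, t \in `]a, b[ -> psi t = phi t].

(* exp X is the value at time 1 of the integral curve of X through the
   identity. The default value 1 of [xget] is never taken on [lie_algebra],
   whose members are complete. *)
Definition lie_exp X : G :=
  xget 1%g [set g | exists gam : R -> G,
    [/\ integral_curve_on setT X gam, gam 0 = 1%g & gam 1 = g]].

Definition lie_automorphism (F : G -> G) : Prop :=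
  [/\ {morph F : x y / (x * y)%g}, smooth_map F &
      exists F', [/\ cancel F F', cancel F' F & smooth_map F']].

Definition is_flow X (phi : R -> G -> G) : Prop :=
  forall g, phi 0 g = g /\ integral_curve_on setT X (phi ^~ g).

Definition one_parameter_automorphism_group (phi : R -> G -> G) : Prop :=
  [/\ forall t, lie_automorphism (phi t), phi 0 = id &
      forall s t, phi (s + t) = phi s \o phi t].

Definition linear_vf X : Prop :=
  vector_field X /\
  exists phi, is_flow X phi /\ one_parameter_automorphism_group phi.

Definition derivation_of X : vfield -> vfield := fun Z => - bracket X Z.

Definition inner_derivation (D : vfield -> vfield) : Prop :=
  exists2 W, lie_algebra W &
    forall Z, lie_algebra Z -> vf_eq (D Z) (bracket W Z).

End VectorFields.

Arguments vfield {R n} G.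

(* Main.v *)
Require Import Defs.
From mathcomp Require Import all_boot all_order all_algebra.
From mathcomp Require Import all_classical all_reals all_analysis.
From mathcomp Require Import ring lra.
Import Order.TTheory.
Import GRing.Theory Num.Theory.
Import numFieldNormedType.Exports.
Local Open Scope classical_set_scope.
Local Open Scope ring_scope.

Set Implicit Arguments.
Unset Strict Implicit.
Unset Printing Implicit Defensive.

(** Put A = X + Y + sum_j u_j (X_j + Y_j) and B = sum_i u_i X_i with u_0 = 1.
    Both are right invariant, and since the i-th linear field is X_i + dI X_i,
    the field that drives the system is A + dI B. An integral curve of A moves
    by left translations; the inverse of an integral curve of B is an integral
    curve of dI B and moves by right translations. Left and right translations
    commute, so that exp (tA) exp (-tB) follows A + dI B
    ([affine_field_solution]).

    Behind this is one rule, [integral_curve_mul]: if gam follows A + dI B and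
    del follows B + dI C, then gam * del follows A + dI C. It comes from the
    product rule for curves in the group ([derive_mul_curve]) and from the fact
    that the inversion has differential - id at the identity
    ([lie_algebra_inv1]). Let alpha and beta be the integral curves of A and B
    through the identity. The rule shows that alpha * beta^-1 is a solution, and
    also that it is the only one: if psi is a solution, then
    alpha^-1 * psi * beta follows the zero field, hence is constant
    ([zero_curve_constant]). The case B = 0 of this argument gives uniqueness of
    the integral curves of A.

    Existence of alpha and beta for all times is what makes exp meaningful.
    Locally it is the Picard-Lindelof theorem in a chart ([picard_local]),
    proved by contraction on a small time interval. By uniqueness a local
    solution satisfies alpha (s + t) = alpha s * alpha t, and squaring
    alpha (t / 2) doubles its interval of definition
    ([integral_curve_double]). Evaluating a vector field on translates of f, or
    on f composed with the inversion, requires these functions to be smooth,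
    which rests on the chain rule for C^k maps ([Ck_on_comp]). *)

(** * Calculus of C^k and smooth maps *)

Section CkCalculus.
Context {R : realType}.
Implicit Types (V W : normedModType R) (k : nat).

Lemma near_eq_differentiable V W (f g : V -> W) (x : V) :
  (\near x, f x = g x) -> differentiable f x -> differentiable g x.
Proof.
move=> fg /diff_locallyP [df_cont dfE].
have gE : g \o shift x = cst (g x) + ('d f x : V -> W) +o_ 0 id.
  apply/eqaddoP => e e0; move/eqaddoP: dfE => /(_ e e0).
  have fg0 : \forall y \near (0 : V), f (y + x) = g (y + x).
    rewrite (near_shift x) /=; near=> z; rewrite /= sub0r subrK.
    by near: z.
  move=> fe; near=> y.
  have : `|(f \o shift x - (cst (f x) + 'd f x)) y| <= e * `|id y|.
    by near: y.
  by rewrite !fctE /= (near fg0 y) ?(nbhs_singleton fg).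
have dgE := diff_unique df_cont gE.
by apply/diff_locallyP; rewrite dgE.
Unshelve. all: by end_near. Qed.

Lemma Ck_on_sub V W k (U U' : set V) (f : V -> W) :
  U' `<=` U -> Ck_on k U f -> Ck_on k U' f.
Proof.
move=> sub; elim: k f => [|k IH] f /=; first by move=> fc x /sub /fc.
by case=> df Df; split=> [x /sub /df //|v]; exact: IH.
Qed.

Lemma Ck_on_ext V W k (U : set V) (f g : V -> W) :
  open U -> (forall x, U x -> f x = g x) -> Ck_on k U f -> Ck_on k U g.
Proof.
move=> oU; elim: k f g => [|k IH] f g fg /=.
  move=> fc x Ux; have fgx : \forall y \near x, f y = g y.
    by apply: filterS fg _; exact: open_nbhs_nbhs.
  rewrite /prop_for /continuous_at -fg //; apply: cvg_trans (fc _ Ux).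
  exact: near_eq_cvg.
case=> df Df; have fgn x : U x -> \forall y \near x, f y = g y.
  by move=> Ux; apply: filterS fg _; exact: open_nbhs_nbhs.
split=> [x Ux|v]; first exact: near_eq_differentiable (fgn _ Ux) (df _ Ux).
by apply: IH (Df v) => x Ux; apply: near_eq_derive; exact: fgn.
Qed.

Lemma Ck_onW V W k (U : set V) (f : V -> W) : Ck_on k.+1 U f -> Ck_on k U f.
Proof.
elim: k f => [|k IH] f.
  by case=> df _ x /df; exact: differentiable_continuous.
by case=> df Df; split=> // v; exact/IH/Df.
Qed.

Lemma Ck_on_cst V W k (U : set V) (c : W) : open U -> Ck_on k U (cst c).
Proof.
move=> oU; elim: k c => [|k IH] c /=; first by move=> x _; exact: cst_continuous.
split=> [x _|v]; first exact: differentiable_cst.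
by apply: Ck_on_ext (IH 0) => // x _; rewrite derive_cst.
Qed.

Lemma Ck_onD V W k (U : set V) (f g : V -> W) : open U ->
  Ck_on k U f -> Ck_on k U g -> Ck_on k U (fun x => f x + g x).
Proof.
move=> oU; elim: k f g => [|k IH] f g /=.
  by move=> fc gc x Ux; apply: continuousD; [exact: fc|exact: gc].
case=> df Df [dg Dg]; split=> [x Ux|v].
  by apply: differentiableD; [exact: df|exact: dg].
apply: Ck_on_ext (IH _ _ (Df v) (Dg v)) => // x Ux.
by rewrite (@deriveD _ _ _ f g) //; apply: diff_derivable; [exact: df|exact: dg].
Qed.

Lemma Ck_onZ V W k (U : set V) (c : R) (f : V -> W) : open U ->
  Ck_on k U f -> Ck_on k U (fun x => c *: f x).
Proof.
move=> oU; elim: k f => [|k IH] f /=.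
  by move=> fc x Ux; apply: cvgZl_tmp; exact: fc.
case=> df Df; split=> [x Ux|v]; first by apply: differentiableZ; exact: df.
apply: Ck_on_ext (IH _ (Df v)) => // x Ux.
by rewrite (@deriveZ _ _ _ f) //; apply: diff_derivable; exact: df.
Qed.

Lemma Ck_onM V k (U : set V) (f g : V -> R) : open U ->
  Ck_on k U f -> Ck_on k U g -> Ck_on k U (fun x => f x * g x).
Proof.
move=> oU; elim: k f g => [|k IH] f g.
  by move=> fc gc x Ux; apply: continuousM; [exact: fc|exact: gc].
move=> Cf Cg; have [df Df] := Cf; have [dg Dg] := Cg; split=> [x Ux|v].
  by apply: differentiableM; [exact: df|exact: dg].
have := Ck_onD oU (IH _ _ (Ck_onW Cf) (Dg v)) (IH _ _ (Ck_onW Cg) (Df v)).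
apply: Ck_on_ext => // x Ux.
by rewrite (@deriveM _ _ f g) //; apply: diff_derivable; [exact: df|exact: dg].
Qed.

Lemma Ck_on_sum V k (U : set V) n (f : 'I_n -> V -> R) : open U ->
  (forall i, Ck_on k U (f i)) -> Ck_on k U (fun x => \sum_i f i x).
Proof.
move=> oU; elim: n f => [|n IH] f Cf.
  apply: Ck_on_ext (Ck_on_cst _ _ oU) => // x _.
  by rewrite big_ord0.
apply: Ck_on_ext (Ck_onD oU (IH _ (fun i => Cf (widen_ord (leqnSn n) i)))
                         (Cf ord_max)) => // x _.
by rewrite big_ord_recr.
Qed.

Lemma derive_coord V m n (f : V -> 'M[R]_(m, n)) (x v : V) i j :
  differentiable f x -> 'D_v (fun y => f y i j) x = ('D_v f x) i j.
Proof. by move=> df; rewrite derive_mx ?mxE //; exact: diff_derivable. Qed.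

Lemma differentiable_mx_coord V m n (f : V -> 'M[R]_(m, n)) (x : V) i j :
  differentiable f x -> differentiable (fun y => f y i j) x.
Proof.
move=> df; exact: (differentiable_comp df (differentiable_coord _ i j)).
Qed.

Lemma Ck_on_coord V m n k (U : set V) (f : V -> 'M[R]_(m, n)) i j : open U ->
  Ck_on k U f -> Ck_on k U (fun x => f x i j).
Proof.
move=> oU; elim: k f => [|k IH] f /=.
  move=> fc x Ux; apply: (continuous_comp (f := f) (g := fun M => M i j)).
    exact: fc.
  exact: coord_continuous.
case=> df Df; split=> [x Ux|v]; first exact/differentiable_mx_coord/df.
by apply: Ck_on_ext (IH _ (Df v)) => // x Ux; rewrite derive_coord //; exact: df.
Qed.

Lemma derive_sum_coord n W (g : 'rV[R]_n -> W) (x v : 'rV[R]_n) :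
  differentiable g x ->
  'D_v g x = \sum_i v 0 i *: 'D_(delta_mx 0 i) g x.
Proof.
move=> dg; rewrite deriveE // {1}(row_sum_delta v) linear_sum /=.
by apply: eq_bigr => i _; rewrite linearZ /= (deriveE _ dg).
Qed.

Lemma derive_compE V W W' (f : V -> W) (g : W -> W') (x v : V) :
  differentiable f x -> differentiable g (f x) ->
  'D_v (g \o f) x = 'D_('D_v f x) g (f x).
Proof.
move=> df dg; rewrite (deriveE _ (differentiable_comp df dg)) (deriveE _ df).
by rewrite (deriveE _ dg) (diff_comp df dg).
Qed.

(** Chain rule for C^k maps: D_v(g o f) = sum_i (D_v f)_i (D_(e_i) g) o f, so
    the order of differentiability drops by one on both sides and the induction
    closes. *)
Lemma Ck_on_comp V n k (U : set V) (U' : set 'rV[R]_n) (f : V -> 'rV[R]_n)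
    (g : 'rV[R]_n -> R) : open U -> (forall x, U x -> U' (f x)) ->
  Ck_on k U f -> Ck_on k U' g -> Ck_on k U (g \o f).
Proof.
move=> oU UU'; elim: k g => [|k IH] g.
  move=> fc gc x Ux; apply: continuous_comp; first exact: fc.
  exact/gc/UU'.
move=> Cf Cg; have [df Df] := Cf; have [dg Dg] := Cg; split=> [x Ux|v].
  by apply: differentiable_comp; [exact: df|exact/dg/UU'].
have Ci i : Ck_on k U (fun x => ('D_v f x) 0 i * 'D_(delta_mx 0 i) g (f x)).
  apply: Ck_onM => //; first exact: (Ck_on_coord _ _ oU (Df v)).
  exact: IH (Ck_onW Cf) (Dg _).
apply: Ck_on_ext (Ck_on_sum oU Ci) => // x Ux.
rewrite (derive_compE v (df x Ux) (dg _ (UU' _ Ux))).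
by rewrite (derive_sum_coord _ (dg _ (UU' _ Ux))).
Qed.

(** Stated for an arbitrary source and target, as it serves to freeze one of the
    two factors of the group law read in charts. *)
Lemma Ck_on_comp_affine V V' W k (U : set V') (f : V' -> W) (h L : V -> V') :
  open U -> (forall x : V, is_diff x h L) ->
  Ck_on k U f -> Ck_on k (h @^-1` U) (f \o h).
Proof.
move=> oU dh; have hd x : differentiable h x by have := dh x.
have hc x : {for x, continuous h} by exact: differentiable_continuous.
have ohU : open (h @^-1` U) by apply: open_comp => // x _; exact: hc.
elim: k f => [|k IH] f /=.
  by move=> fc x Ux; apply: continuous_comp; [exact: hc|exact: fc].
case=> df Df; split=> [x Ux|v].
  by apply: differentiable_comp; last exact: df.
apply: Ck_on_ext (IH _ (Df (L v))) => // x Ux.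
rewrite derive_compE //; last exact: df.
by rewrite (deriveE _ (hd x)) (@diff_val _ _ _ _ _ _ _ (dh x)).
Qed.

Lemma smooth_near_ext V W (x : V) (f g : V -> W) :
  (\near x, f x = g x) -> smooth_near x f -> smooth_near x g.
Proof.
move=> fg [U [oU Ux] sf]; exists (U `&` [set y | f y = g y]^°).
  by split; [exact/openI/open_interior|split].
move=> k; apply: (Ck_on_ext (f := f)); first exact/openI/open_interior.
  by move=> y [_ /interior_subset].
by apply: Ck_on_sub (sf k) => y [].
Qed.

Lemma smooth_near_differentiable V W (x : V) (f : V -> W) :
  smooth_near x f -> differentiable f x.
Proof. by case=> U [_ Ux] /(_ 1%N) [] df _; exact: df. Qed.

Lemma smooth_near_coord V m n (x : V) (f : V -> 'M[R]_(m, n)) i j :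
  smooth_near x f -> smooth_near x (fun y => f y i j).
Proof.
by case=> U [oU Ux] sf; exists U => // k; exact: Ck_on_coord.
Qed.

Lemma smooth_near_comp V n (x : V) (f : V -> 'rV[R]_n) (g : 'rV[R]_n -> R) :
  smooth_near x f -> smooth_near (f x) g -> smooth_near x (g \o f).
Proof.
case=> U [oU Ux] sf [U' [oU' Ux'] sg].
have oUU' : open (U `&` f @^-1` U').
  rewrite openE => y [Uy Uy']; apply: filterI.
    exact: open_nbhs_nbhs.
  by have [df _] := sf 1%N; apply: (differentiable_continuous (df y Uy));
    exact: open_nbhs_nbhs.
exists (U `&` f @^-1` U') => // k.
apply: (Ck_on_comp (U' := U')) => //; first by move=> y [].
by apply: Ck_on_sub (sf k) => y [].
Qed.

Lemma smooth_near_comp_affine V V' W (x : V) (f : V' -> W) (h L : V -> V') :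
  (forall y : V, is_diff y h L) -> smooth_near (h x) f -> smooth_near x (f \o h).
Proof.
move=> dh [U [oU Ux] sf]; exists (h @^-1` U).
  split=> //; apply: open_comp => // y _; apply: differentiable_continuous.
  by have := dh y.
by move=> k; exact: Ck_on_comp_affine dh (sf k).
Qed.

End CkCalculus.

(** * Smooth functions and differentiable curves on a Lie group *)

Section SmoothFunctions.
Context {R : realType} {n : nat} {G : lieGroupType R n}.
Implicit Types (f : G -> R) (p g h : G) (c d : chart R n G).

Lemma near_chart_inv c p (D : set G) : chart_dom c p -> nbhs p D ->
  \forall x \near chart_map c p, D (chart_inv c x).
Proof.
move=> cp nD; apply: (chart_inv_continuous (chart_map_img cp)).
by rewrite chart_mapK.
Qed.

Lemma near_chart_dom c p : chart_dom c p -> \forall q \near p, chart_dom c q.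
Proof. by move=> cp; apply: open_nbhs_nbhs; split=> //; exact: chart_dom_open. Qed.

(** Chart coordinates are admissible test functions because the atlas is
    smoothly compatible; testing on them recovers the velocity of a curve in a
    chart. *)
Lemma smooth_at_chart_coord c p i : atlas c -> chart_dom c p ->
  smooth_at (fun q => chart_map c q 0 i) p.
Proof.
move=> ac cp d ad dp; apply: smooth_near_coord.
exists [set x | chart_img d x /\ chart_dom c (chart_inv d x)]; last first.
  exact: atlas_compatible.
split; last by split; [exact: chart_map_img|rewrite chart_mapK].
rewrite openE => x [dx cx]; apply: filterI.
  by apply: open_nbhs_nbhs; split=> //; exact: chart_img_open.
exact/(chart_inv_continuous dx)/near_chart_dom.
Qed.

Lemma smooth_at_comp (F : G -> G) f p :
  smooth_map F -> smooth_at f (F p) -> smooth_at (f \o F) p.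
Proof.
move=> [cF sF] sf c ac cp; have [d ad dFp] := atlas_cover (F p).
have := smooth_near_comp (sF p c d ac ad cp dFp).
rewrite /= chart_mapK // => /(_ _ (sf d ad dFp)).
apply: smooth_near_ext; apply: (@near_chart_inv c p
  [set q | (f \o chart_inv d) (chart_map d (F q)) = f (F q)]) => //.
have : nbhs p (F @^-1` chart_dom d) by exact/cF/near_chart_dom.
by apply: filterS => q dFq; rewrite /= chart_mapK.
Qed.

Lemma smooth_map_inv : smooth_map (fun x : G => x^-1%g).
Proof.
by split=> [|p c d ac ad cp dp]; [exact: lie_inv_continuous|exact: lie_inv_smooth].
Qed.

Lemma smooth_map_mulr h : smooth_map (fun x : G => (x * h)%g).
Proof.
split=> [x|p c d ac ad cp dp].
  apply: (continuous_comp (f := fun y : G => (y, h))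
                          (g := fun z : G * G => (z.1 * z.2)%g)).
    by apply: cvg_pair; [exact: cvg_id|exact: cvg_cst].
  exact: lie_mul_continuous.
have [b ab bh] := atlas_cover h.
pose L (x : 'rV[R]_n) : 'rV[R]_n * 'rV[R]_n := (x, 0).
have dL (x : 'rV[R]_n) : is_diff x (fun y => (y, chart_map b h)) L.
  exact: is_diff_pair.
apply: smooth_near_ext
  (smooth_near_comp_affine dL (lie_mul_smooth p h c b d ac ab ad cp bh dp)).
by near=> x; rewrite /= chart_mapK.
Unshelve. all: by end_near. Qed.

Lemma smooth_map_mull h : smooth_map (fun x : G => (h * x)%g).
Proof.
split=> [x|p c d ac ad cp dp].
  apply: (continuous_comp (f := fun y : G => (h, y))
                          (g := fun z : G * G => (z.1 * z.2)%g)).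
    by apply: cvg_pair; [exact: cvg_cst|exact: cvg_id].
  exact: lie_mul_continuous.
have [b ab bh] := atlas_cover h.
pose L (x : 'rV[R]_n) : 'rV[R]_n * 'rV[R]_n := (0, x).
have dL (x : 'rV[R]_n) : is_diff x (fun y => (chart_map b h, y)) L.
  exact: is_diff_pair.
apply: smooth_near_ext
  (smooth_near_comp_affine dL (lie_mul_smooth h p b c d ab ac ad bh cp dp)).
by near=> x; rewrite /= chart_mapK.
Unshelve. all: by end_near. Qed.

End SmoothFunctions.

Section DifferentiableCurves.
Context {R : realType} {n : nat} {G : lieGroupType R n}.
Implicit Types (f : G -> R) (gam del : R -> G) (c d : chart R n G) (t : R).

(** Differentiability is tested on scalar functions, as in
    [integral_curve_on]; [chart_curve_derivable] translates it to charts. *)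
Definition curve_differentiable gam t : Prop :=
  {for t, continuous gam} /\
  forall f, smooth_at f (gam t) -> derivable (f \o gam) t 1.

Lemma integral_curve_onP (J : set R) (X : vfield G) gam :
  integral_curve_on J X gam <->
  forall t, J t -> curve_differentiable gam t /\
    forall f, smooth_at f (gam t) -> 'D_1 (f \o gam) t = X f (gam t).
Proof.
split=> Jgam t Jt.
  have [cg dg] := Jgam t Jt; split; first split=> // f /dg df.
    exact: ex_derive.
  by move=> f /dg df; exact: derive_val.
have [[cg dg] Dg] := Jgam t Jt; split=> // f sf.
by split; [exact: dg|exact: Dg].
Qed.

Lemma chart_curve_derivable gam t c : atlas c -> chart_dom c (gam t) ->
  curve_differentiable gam t -> derivable (chart_map c \o gam) t 1.
Proof.
move=> ac cg [_ dg]; apply/derivable_mxP => i j; rewrite (ord1 i).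
exact: (dg (fun q => chart_map c q 0 j) (smooth_at_chart_coord _ ac cg)).
Qed.

Lemma is_derive_chart_curve gam t c v f : chart_dom c (gam t) ->
  {for t, continuous gam} -> is_derive t 1 (chart_map c \o gam) v ->
  atlas c -> smooth_at f (gam t) ->
  is_derive t (1 : R) (f \o gam) ('D_v (f \o chart_inv c) (chart_map c (gam t))).
Proof.
move=> cg gc dg ac sf.
have df : differentiable (f \o chart_inv c) ((chart_map c \o gam) t).
  exact/smooth_near_differentiable/sf.
have dx : differentiable (chart_map c \o gam) t.
  by apply/derivable1_diffP; exact: ex_derive.
have cgn : \forall s \near t, chart_dom c (gam s) by exact/gc/near_chart_dom.
apply: (near_eq_is_derive (f := (f \o chart_inv c) \o (chart_map c \o gam))).
  by apply: filterS cgn => s cs; rewrite /= chart_mapK.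
split; first exact/diff_derivable/differentiable_comp.
by rewrite derive_compE // derive_val.
Qed.

(** The product rule for curves in the group: in charts, f(gam * del) is a
    differentiable function of two vector variables composed with a pair of
    differentiable curves, and its differential splits along the two factors. *)
Lemma derive_mul_curve gam del t f :
  curve_differentiable gam t -> curve_differentiable del t ->
  smooth_at f (gam t * del t)%g ->
  is_derive t (1 : R) (fun s => f (gam s * del s)%g)
    ('D_1 (fun s => f (gam s * del t)%g) t +
     'D_1 (fun s => f (gam t * del s)%g) t).
Proof.
move=> dg dd sf.
have [a aa ag] := atlas_cover (gam t); have [b ab bd] := atlas_cover (del t).
have [c ac cgd] := atlas_cover (gam t * del t)%g.
pose x := chart_map a \o gam; pose y := chart_map b \o del.
have dx : differentiable x t.
  exact/derivable1_diffP/chart_curve_derivable.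
have dy : differentiable y t.
  exact/derivable1_diffP/chart_curve_derivable.
pose mu (z : 'rV[R]_n * 'rV[R]_n) : 'rV[R]_n :=
  chart_map c (chart_inv a z.1 * chart_inv b z.2)%g.
have dmu : differentiable mu (x t, y t).
  exact/smooth_near_differentiable/lie_mul_smooth.
have muE : mu (x t, y t) = chart_map c (gam t * del t)%g.
  by rewrite /mu /x /y /= !chart_mapK.
pose H := (f \o chart_inv c) \o mu.
have dH : differentiable H (x t, y t).
  apply: differentiable_comp => //.
  by rewrite muE; exact/smooth_near_differentiable/sf.
(* The same H serves three pairs of curves: both factors moving, and each
   factor moving while the other one is kept at its value at time t. *)
have HE (gam' del' : R -> G) : {for t, continuous gam'} ->
    {for t, continuous del'} -> gam' t = gam t -> del' t = del t ->
    \forall s \near t, H (chart_map a (gam' s), chart_map b (del' s)) =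
                       f (gam' s * del' s)%g.
  move=> gc dc gt dt.
  have ags : \forall s \near t, chart_dom a (gam' s).
    by apply/gc/near_chart_dom; rewrite gt.
  have bds : \forall s \near t, chart_dom b (del' s).
    by apply/dc/near_chart_dom; rewrite dt.
  have cs : \forall s \near t, chart_dom c (gam' s * del' s)%g.
    have gdc : {for t, continuous (fun s => (gam' s * del' s)%g)}.
      apply: (continuous_comp (f := fun s => (gam' s, del' s))
                              (g := fun z : G * G => (z.1 * z.2)%g)).
        exact: cvg_pair.
      exact: lie_mul_continuous.
    by apply/gdc/near_chart_dom; rewrite gt dt.
  near=> s.
  have As : chart_dom a (gam' s) by near: s.
  have Bs : chart_dom b (del' s) by near: s.
  have Cs : chart_dom c (gam' s * del' s)%g by near: s.
  by rewrite /H /mu /= (chart_mapK As) (chart_mapK Bs) (chart_mapK Cs).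
have [gc _] := dg; have [dc _] := dd.
have gct : {for t, continuous (fun=> gam t)} by exact: cst_continuous.
have dct : {for t, continuous (fun=> del t)} by exact: cst_continuous.
have D (x' y' : R -> 'rV[R]_n) : differentiable x' t -> differentiable y' t ->
    x' t = x t -> y' t = y t ->
    is_derive t 1 (fun s => H (x' s, y' s)) ('d H (x t, y t) ('D_1 x' t, 'D_1 y' t)).
  move=> dx' dy' xt yt.
  have dxy := differentiable_pair dx' dy'.
  have dH' : differentiable H (x' t, y' t) by rewrite xt yt.
  split; first exact/diff_derivable/(differentiable_comp dxy).
  rewrite (derive_compE _ dxy dH') (deriveE _ dH') (deriveE _ dxy).
  by rewrite (diff_pair dx' dy') xt yt !deriveE.
have D2 := near_eq_is_derive (HE _ _ gc dc erefl erefl) (D x y dx dy erefl erefl).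
have D1l := near_eq_is_derive (HE _ _ gc dct erefl erefl)
  (D x (cst (y t)) dx (differentiable_cst _ _) erefl erefl).
have D1r := near_eq_is_derive (HE _ _ gct dc erefl erefl)
  (D (cst (x t)) y (differentiable_cst _ _) dy erefl erefl).
apply: is_derive_eq D2 _; rewrite (@derive_val _ _ _ _ _ _ _ D1l).
rewrite (@derive_val _ _ _ _ _ _ _ D1r) -linearD /= !derive_cst.
by congr ('d H _ _); rewrite /GRing.add /= /add_pair /= addr0 add0r.
Unshelve. all: by end_near. Qed.

Lemma curve_differentiable_mul gam del t :
  curve_differentiable gam t -> curve_differentiable del t ->
  curve_differentiable (fun s => (gam s * del s)%g) t.
Proof.
move=> dg dd; have [gc _] := dg; have [dc _] := dd; split.
  apply: (continuous_comp (f := fun s => (gam s, del s))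
                          (g := fun z : G * G => (z.1 * z.2)%g)).
    exact: cvg_pair.
  exact: lie_mul_continuous.
by move=> f sf; have D := derive_mul_curve dg dd sf; exact: ex_derive.
Qed.

End DifferentiableCurves.

(** * Local solutions of ordinary differential equations *)

Section LocalExistence.
Context {R : realType}.
Implicit Types (a b e h t : R) (n : nat).

Lemma mx_norm_leP m n (x : 'M[R]_(m, n)) e : 0 <= e ->
  (forall i j, `|x i j| <= e) <-> `|x| <= e.
Proof.
move=> e0; rewrite {2}/Num.Def.normr /= mx_normrE; split=> [xe|].
  by apply: bigmax_le => // -[i j] _.
by move=> /bigmax_leP [_ xe] i j; exact: (xe (i, j)).
Qed.

Lemma mean_value_le (f f' : R -> R) a b e :
  (forall t, Num.min a b <= t <= Num.max a b -> is_derive t (1 : R) f (f' t)) ->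
  (forall t, Num.min a b <= t <= Num.max a b -> `|f' t| <= e) ->
  `|f b - f a| <= e * `|b - a|.
Proof.
wlog ab : a b / a <= b => [H df f'e|].
  have [ab|/ltW ba] := leP a b; first exact: H.
  by rewrite distrC (distrC b); apply: H => // t; rewrite minC maxC; auto.
rewrite (min_idPl ab) (max_idPr ab) => df f'e.
have [|||c] := @MVT_segment _ f f' a b.
- by [].
- by move=> x; rewrite in_itv /= => /andP[/ltW ax /ltW xb]; apply: df; rewrite ax.
- apply: derivable_within_continuous => x; rewrite in_itv /= => axb.
  by have := df x axb => ?; exact: ex_derive.
rewrite in_itv /= => acb ->; rewrite normrM.
by rewrite ler_wpM2r // f'e.
Qed.

Lemma geometric_half_small (M e : R) : 0 < e ->
  exists N, forall k, (N <= k)%N -> M * 2^-1 ^+ k < e.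
Proof.
move=> e0; have h1 : `|2^-1 : R| < 1 by rewrite ger0_norm //; lra.
have /cvgrPdist_lt /(_ _ e0) [N _ HN] := cvg_geometric M h1.
exists N => k /HN /=; rewrite sub0r normrN /geometric /=.
exact/le_lt_trans/ler_norm.
Qed.

(** Banach's fixed point theorem for the supremum norm, on functions that need
    not be bounded: only one displacement T f0 - f0 has to be. *)
Lemma sup_contraction_fixpoint n (T : (R -> 'rV[R]_n) -> R -> 'rV[R]_n) f0 M :
  (forall f, continuous f -> continuous (T f)) ->
  (forall f g e, continuous f -> continuous g ->
    (forall t, `|f t - g t| <= e) -> forall t, `|T f t - T g t| <= e / 2) ->
  continuous f0 -> (forall t, `|T f0 t - f0 t| <= M) ->
  exists2 f, continuous f & forall t, T f t = f t.
Proof.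
move=> Tc Tcontr f0c f0M; pose F k := iter k T f0.
have Fc k : continuous (F k) by elim: k => //= k; exact: Tc.
(* B k is the sum of the geometric series of the later displacements, so
   that the distances telescope. *)
pose B k : R := (M * 2) * 2^-1 ^+ k.
have Bstep k : B k - B k.+1 = M * 2^-1 ^+ k by rewrite /B exprS; field.
have Bhalf k : B k / 2 = B k.+1 by rewrite /B exprS; field.
have M0 : 0 <= M by exact: le_trans (normr_ge0 _) (f0M 0).
have B0 k : 0 <= B k by rewrite /B !mulr_ge0 // exprn_ge0 // invr_ge0.
have Fstep k t : `|F k.+1 t - F k t| <= B k - B k.+1.
  rewrite Bstep; elim: k t => [|k IH] t; first by rewrite expr0 mulr1; exact: f0M.
  by rewrite exprSr mulrA; exact: (Tcontr _ _ _ (Fc k.+1) (Fc k) IH).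
have Fdist k j t : `|F (j + k)%N t - F k t| <= B k - B (j + k)%N.
  elim: j => [|j IH]; first by rewrite add0n !subrr normr0.
  rewrite addSn -(subrKA (F (j + k)%N t)) (le_trans (ler_normD _ _)) //.
  by have := Fstep (j + k)%N t; lra.
have Fcv t : cvgn (F ^~ t).
  apply/cauchy_cvgP/cauchy_exP => e e0.
  have [N HN] := geometric_half_small (M * 2) e0; exists (F N t).
  exists N => // k /= Nk; rewrite -ball_normE /= distrC -(subnK Nk).
  by have := Fdist N (k - N)%N t; have := HN N (leqnn N); rewrite -/(B N);
    have := B0 (k - N + N)%N; lra.
pose f t := lim (F ^~ t @ \oo).
have fF k t : `|f t - F k t| <= B k.
  apply/ler_addgt0Pr => e e0.
  have /cvgrPdist_le /(_ _ e0) [N _ HN] := Fcv t.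
  have := HN (N + k)%N (leq_addr _ _); rewrite /= -/(f t) => fN.
  rewrite -(subrKA (F (N + k)%N t)) (le_trans (ler_normD _ _)) //.
  by have := Fdist k N t; have := B0 (N + k)%N; lra.
have fc : continuous f.
  move=> t; apply/cvgrPdist_le => e e0.
  have e3 : 0 < e / 3 by rewrite divr_gt0.
  have [N HN] := geometric_half_small (M * 2) e3.
  have /cvgrPdist_le /(_ _ e3) := Fc N t; apply: filterS => s Fts.
  rewrite -(subrKA (F N t)) (le_trans (ler_normD _ _)) //.
  rewrite -(subrKA (F N s) (F N t)) (le_trans (lerD (lexx _) (ler_normD _ _))) //.
  have := fF N t; have := fF N s; rewrite distrC; have := HN N (leqnn N).
  by rewrite -/(B N); lra.
exists f => // t; apply/eqP; rewrite -subr_eq0 -normr_le0.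
apply/ler_addgt0Pr => e e0; rewrite add0r.
have [N HN] := geometric_half_small (M * 2) e0.
rewrite -(subrKA (F N.+1 t)) (le_trans (ler_normD _ _)) //.
have := Tcontr f (F N) (B N) fc (Fc N) (fF N) t; rewrite /= Bhalf.
have := fF N.+1 t; rewrite distrC; have := HN N (leqnn N); rewrite -/(B N).
by have := Bhalf N; lra.
Qed.

(** The integral starts at -1, to the left of the initial time 0, because the
    fundamental theorem of calculus covers interior points only; the value at 0
    is subtracted afterwards. All uses stay within ]-1, 1[. *)
Definition primitive (g : R -> R) t : R :=
  \int[lebesgue_measure]_(s in `[-1, t]) g s
  - \int[lebesgue_measure]_(s in `[-1, 0]) g s.

Lemma is_derive_primitive (g : R -> R) t : continuous g -> -1 < t ->
  is_derive t (1 : R) (primitive g) (g t).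
Proof.
move=> gc t1.
have tt1 : t < t + 1 by rewrite ltrDl.
have ig : lebesgue_measure.-integrable `[-1, t + 1] (EFin \o g).
  apply: continuous_compact_integrable; first exact: segment_compact.
  exact: continuous_subspaceT.
have [dI DI] := continuous_FTC1_closed tt1 ig t1 (gc t).
rewrite derive1E in DI.
pose F t := \int[lebesgue_measure]_(s in `[-1, t]) g s.
have dF : is_derive t (1 : R) F (g t) by split.
have : is_derive t (1 : R) (F - cst (F 0)) (g t - 0) by exact: is_deriveB.
by rewrite subr0.
Qed.

Definition vprimitive n (g : R -> 'rV[R]_n) t : 'rV[R]_n :=
  \row_i primitive (fun s => g s 0 i) t.

Lemma continuous_row_coord n (g : R -> 'rV[R]_n) i :
  continuous g -> continuous (fun s => g s 0 i).
Proof.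
move=> gc s; apply: (continuous_comp (f := g) (g := fun M => M 0 i)).
  exact: gc.
exact: coord_continuous.
Qed.

Lemma is_derive_vprimitive n (g : R -> 'rV[R]_n) t : continuous g -> -1 < t ->
  is_derive t (1 : R) (vprimitive g) (g t).
Proof.
move=> gc t1.
have dp i : is_derive t (1 : R) (primitive (fun s => g s 0 i)) (g t 0 i).
  by apply: is_derive_primitive => //; exact: continuous_row_coord.
have vE i j : (fun s => vprimitive g s i j) = primitive (fun s => g s 0 j).
  by apply/funext => s; rewrite mxE.
have dv : derivable (vprimitive g) t 1.
  by apply/derivable_mxP => i j; rewrite vE.
split=> //; rewrite derive_mx //; apply/rowP => j; rewrite mxE vE.
by rewrite derive_val.
Qed.

Lemma vprimitive_at0 n (g : R -> 'rV[R]_n) : vprimitive g 0 = 0.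
Proof. by apply/rowP => i; rewrite !mxE /primitive subrr. Qed.

Lemma vprimitive0 n t : vprimitive (cst (0 : 'rV[R]_n)) t = 0.
Proof.
apply/rowP => i; rewrite !mxE /primitive.
rewrite (_ : (fun s => cst (0 : 'rV[R]_n) s 0 i) = cst 0).
  by rewrite !Rintegral_cst //= !mul0r subrr mxE.
by apply/funext => s; rewrite mxE.
Qed.

Lemma vprimitive_dist_le n (g1 g2 : R -> 'rV[R]_n) e t : continuous g1 ->
  continuous g2 -> (forall s, `|g1 s - g2 s| <= e) -> -1 < t ->
  `|vprimitive g1 t - vprimitive g2 t| <= e * `|t|.
Proof.
move=> c1 c2 g12 t1; have e0 : 0 <= e := le_trans (normr_ge0 _) (g12 0).
apply/mx_norm_leP => [|i j]; first by rewrite mulr_ge0.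
rewrite (ord1 i) !mxE.
pose D s := primitive (fun s => g1 s 0 j) s - primitive (fun s => g2 s 0 j) s.
have D0 : D 0 = 0 by rewrite /D /primitive !subrr.
rewrite -[X in `|X|]subr0 -{1}D0 -[X in _ * `|X|]subr0.
apply: (@mean_value_le D (fun s => g1 s 0 j - g2 s 0 j)) => s /andP[ts _].
  have s1 : -1 < s by apply: lt_le_trans ts; rewrite lt_min t1 /=; lra.
  have d1 := is_derive_primitive (continuous_row_coord (i := j) c1) s1.
  have d2 := is_derive_primitive (continuous_row_coord (i := j) c2) s1.
  exact: (is_deriveB d1 d2).
have /(mx_norm_leP _ e0).2 /(_ 0 j) := g12 s.
by rewrite !mxE.
Qed.

(** Clamping turns the local data of a differential equation into global ones:
    it is applied to time, and coordinatewise to space. *)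
Definition clamp a b t := Num.max a (Num.min b t).

Lemma clamp_in a b t : a <= b -> a <= clamp a b t <= b.
Proof.
move=> ab; rewrite /clamp le_max lexx /= ge_max ab ge_min lexx //.
Qed.

Lemma clamp_id a b t : a <= t <= b -> clamp a b t = t.
Proof. by move=> /andP[a_t tb]; rewrite /clamp (min_idPr tb) (max_idPr a_t). Qed.

Lemma clamp_lipschitz a b s t : `|clamp a b s - clamp a b t| <= `|s - t|.
Proof.
have maxL x y : `|Num.max a x - Num.max a y| <= `|x - y|.
  have := ler_norm (x - y); have := lerNnormlW (lexx `|x - y|).
  by rewrite ler_norml; case: (leP a x); case: (leP a y); lra.
apply: le_trans (maxL _ _) _.
have := ler_norm (s - t); have := lerNnormlW (lexx `|s - t|).
by rewrite ler_norml; case: (leP b s); case: (leP b t); lra.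
Qed.

Lemma lipschitz_continuous m n (W : 'rV[R]_m -> 'rV[R]_n) L :
  (forall x y, `|W x - W y| <= L * `|x - y|) -> continuous W.
Proof.
move=> WL x; apply/(@cvgrPdist_le _ _ _ (nbhs x)) => e e0.
have L1 : 0 < `|L| + 1 by rewrite ltr_wpDl.
have e1 : 0 < e / (`|L| + 1) by rewrite divr_gt0.
apply/nbhs_ballP; exists (e / (`|L| + 1)) => //= y.
rewrite -ball_normE /= => /ltW xy.
rewrite (le_trans (WL _ _)) //.
rewrite (@le_trans _ _ ((`|L| + 1) * (e / (`|L| + 1)))) //; last first.
  by rewrite mulrCA divff ?mulr1 // gt_eqF.
apply: le_trans (ler_wpM2l (ltW L1) xy); apply: ler_wpM2r => //.
by have := ler_norm L; lra.
Qed.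

Lemma near_norm_lt t h : `|t| < h -> \forall s \near t, `|s| < h.
Proof.
move=> th; apply/nbhs_ballP; exists (h - `|t|); first by rewrite /= subr_gt0.
move=> s; rewrite -ball_normE /= => ts; rewrite -(subKr t s).
by rewrite (le_lt_trans (ler_normB _ _)) //; lra.
Qed.

(** Picard iteration. The time variable is clamped to [-h, h], so that
    the iteration operates on functions on the whole line, where h is so small
    that the integral operator contracts distances by 1/2. *)
Lemma picard_lipschitz n (W : 'rV[R]_n -> 'rV[R]_n) L x0 : 0 <= L ->
  (forall x y, `|W x - W y| <= L * `|x - y|) ->
  exists2 h, 0 < h & exists2 x : R -> 'rV[R]_n, x 0 = x0 &
    forall t, `|t| < h -> is_derive t (1 : R) x (W (x t)).
Proof.
move=> L0 WL; have Wc := lipschitz_continuous WL.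
pose h : R := (2 * (L + 1))^-1.
have L1 : 0 < L + 1 by rewrite ltr_wpDl.
have h0 : 0 < h by rewrite invr_gt0 mulr_gt0.
have hL : L * h <= 1 / 2.
  by rewrite /h ler_pdivrMr ?mulr_gt0 //; lra.
have h1 : h < 1.
  by rewrite /h invf_lt1 ?mulr_gt0 //; lra.
pose c := clamp (- h) h.
have c_in t : -1 < c t /\ `|c t| <= h.
  have hh : - h <= h by lra.
  have := clamp_in t hh; rewrite -/c => /andP[ch1 ch2].
  by rewrite ler_norml ch1 ch2; split=> //; lra.
have cc : continuous c.
  move=> t; apply/cvgrPdist_le => e e0.
  apply/nbhs_normP; exists e => //= s /ltW.
  exact/le_trans/clamp_lipschitz.
pose T (f : R -> 'rV[R]_n) t := x0 + vprimitive (W \o f) (c t).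
have Wfc (f : R -> 'rV[R]_n) : continuous f -> continuous (W \o f).
  by move=> fc t; exact: (continuous_comp (fc t) (Wc (f t))).
have Tc f : continuous f -> continuous (T f).
  move=> fc t; apply: cvgD; first exact: cvg_cst.
  apply: (continuous_comp (f := c) (g := vprimitive (W \o f))).
    exact: cc.
  apply: differentiable_continuous; apply/derivable1_diffP.
  by have := is_derive_vprimitive (Wfc _ fc) (c_in t).1 => ?; exact: ex_derive.
have Tcontr (f g : R -> 'rV[R]_n) e : continuous f -> continuous g ->
    (forall t, `|f t - g t| <= e) -> forall t, `|T f t - T g t| <= e / 2.
  move=> fc gc fg t; have e0 : 0 <= e := le_trans (normr_ge0 _) (fg 0).
  rewrite /T opprD addrACA subrr add0r.
  have Wfg s : `|(W \o f) s - (W \o g) s| <= L * e.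
    by rewrite (le_trans (WL _ _)) // ler_wpM2l.
  apply: le_trans (vprimitive_dist_le (Wfc _ fc) (Wfc _ gc) Wfg (c_in t).1) _.
  apply: le_trans (_ : L * e * h <= _).
    by rewrite ler_wpM2l ?mulr_ge0 ?(c_in t).2.
  by rewrite mulrAC mulrC; apply: ler_wpM2l => //; lra.
have x0c : continuous (cst x0 : R -> 'rV[R]_n) by exact: cst_continuous.
have T0 t : `|T (cst x0) t - cst x0 t| <= `|W x0| * h.
  rewrite /T /= addrAC subrr add0r -[X in `|X|]subr0 -(vprimitive0 n (c t)).
  have zc : continuous (cst 0 : R -> 'rV[R]_n) by exact: cst_continuous.
  have Wx0 s : `|(W \o cst x0) s - (cst 0 : R -> 'rV[R]_n) s| <= `|W x0|.
    by rewrite /= subr0.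
  have := vprimitive_dist_le (Wfc _ x0c) zc Wx0 (c_in t).1.
  by move/le_trans; apply; rewrite ler_wpM2l // (c_in t).2.
have [x xc Tx] := sup_contraction_fixpoint Tc Tcontr x0c T0.
have cE t : `|t| <= h -> c t = t.
  by rewrite ler_norml => ?; exact: clamp_id.
exists h => //; exists x => [|t th].
  by rewrite -Tx /T cE ?normr0 ?(ltW h0) // vprimitive_at0 addr0.
have tN1 : -1 < t.
  by move: th; rewrite ltr_norml => /andP[+ _]; apply: lt_trans; lra.
have dx : is_derive t (1 : R) (cst x0 + vprimitive (W \o x)) (0 + (W \o x) t).
  exact: is_deriveD (is_derive_cst _ _ _) (is_derive_vprimitive (Wfc _ xc) tN1).
rewrite add0r in dx; apply: near_eq_is_derive dx.
by apply: filterS (near_norm_lt th) => s /ltW sh; rewrite -Tx /T /= cE.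
Qed.

End LocalExistence.

Section LocalSolutions.
Context {R : realType}.
Implicit Types n : nat.

(** The partial derivatives are bounded near x0 by continuity; balls are convex,
    so the mean value inequality along segments gives the Lipschitz bound. *)
Lemma C1_locally_lipschitz n (U : set 'rV[R]_n) (V : 'rV[R]_n -> 'rV[R]_n) x0 :
  open U -> U x0 -> Ck_on 1 U V ->
  exists2 r, 0 < r & exists2 L, 0 <= L &
    (forall y, `|x0 - y| <= r -> U y) /\
    forall y z, `|x0 - y| <= r -> `|x0 - z| <= r -> `|V y - V z| <= L * `|y - z|.
Proof.
move=> oU Ux0 [dV DV].
pose D i := 'D_(delta_mx 0 i) V; pose M i : R := `|D i x0| + 1.
have nM : \forall y \near x0, U y /\ forall i, `|D i y| <= M i.
  apply: filterI; first exact: open_nbhs_nbhs.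
  apply: (@filter_forall _ _ (fun i y => `|D i y| <= M i) (nbhs x0)) => i.
  have /cvgrPdist_le /(_ 1 ltr01) : D i y @[y --> x0] --> D i x0 by exact: DV.
  apply: filterS => y Dy; rewrite /M -(subKr (D i x0) (D i y)).
  by rewrite (le_trans (ler_normB _ _)) // lerD.
have /nbhs_ballP [r0 /= r0_gt0 nr0] := nM.
pose r := r0 / 2; have r_gt0 : 0 < r by rewrite divr_gt0.
have Br y : `|x0 - y| <= r -> U y /\ forall i, `|D i y| <= M i.
  move=> yr; apply: nr0; rewrite -ball_normE /=; apply: le_lt_trans yr _.
  by rewrite /r; lra.
have M0 i : 0 <= M i by rewrite addr_ge0.
exists r => //; exists (\sum_i M i); first by rewrite sumr_ge0.
split=> [y /Br [] //|y z yr zr].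
have sM0 : 0 <= (\sum_i M i) * `|y - z| by rewrite mulr_ge0 // sumr_ge0.
apply/mx_norm_leP => // i j; rewrite (ord1 i) !mxE.
pose line (s : R) := z + s *: (y - z).
have line1 : line 1 = y by rewrite /line scale1r addrC subrK.
have line0 : line 0 = z by rewrite /line scale0r addr0.
have dl (s : R) : is_diff s line (cst 0 + *:%R^~ (y - z)).
  exact: (is_diffD (is_diff_cst z s) (is_diff_scalel s (y - z))).
have dline s : differentiable line s by have := dl s.
have Dline s : 'D_1 line s = y - z.
  by rewrite deriveE // (@diff_val _ _ _ _ _ _ _ (dl s)) fctE /= add0r scale1r.
have line_in s : 0 <= s <= 1 -> `|x0 - line s| <= r.
  move=> /andP[s0 s1].
  have -> : x0 - line s = (1 - s) *: (x0 - z) + s *: (x0 - y).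
    by rewrite /line; apply/rowP => k; rewrite !mxE; ring.
  rewrite (le_trans (ler_normD _ _)) // !normrZ.
  rewrite (ger0_norm s0) (ger0_norm (_ : 0 <= 1 - s)) ?subr_ge0 //.
  have := ler_wpM2l s0 yr; have := ler_wpM2l (_ : 0 <= 1 - s) zr.
  by rewrite subr_ge0 s1 => /(_ isT); lra.
have := mean_value_le (f := fun s => V (line s) 0 j)
  (f' := fun s => ('D_(y - z) V (line s)) 0 j)
  (a := 0) (b := 1) (e := (\sum_i M i) * `|y - z|).
rewrite /= line1 line0 subr0 normr1 mulr1.
apply; rewrite (min_idPl ler01) (max_idPr ler01) => s /line_in sr.
- have Vd : differentiable V (line s) by apply: dV; have [] := Br _ sr.
  have VL := differentiable_comp (dline s) Vd.
  split; first exact/diff_derivable/differentiable_mx_coord.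
  transitivity (('D_1 (V \o line) s) 0 j); first exact: derive_coord VL.
  by rewrite (derive_compE _ (dline s) Vd) Dline.
- have [Us Ds] := Br _ sr.
  have /(mx_norm_leP _ sM0) : `|'D_(y - z) V (line s)| <= (\sum_i M i) * `|y - z|.
    rewrite (derive_sum_coord _ (dV _ Us)) (le_trans (ler_norm_sum _ _ _)) //.
    rewrite mulr_suml; apply: ler_sum => k _; rewrite normrZ mulrC.
    apply: ler_pM => //; first exact: Ds.
    exact: ((mx_norm_leP (y - z) (normr_ge0 _)).2 (lexx _) 0 k).
  exact.
Qed.

(** The field is replaced by its composition with the projection onto a closed
    box (a ball of the sup norm), which is 1-Lipschitz and therefore yields a
    globally Lipschitz field; a solution stays in the box for a short time. *)
Theorem picard_local n (U : set 'rV[R]_n) (V : 'rV[R]_n -> 'rV[R]_n) x0 :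
  open U -> U x0 -> Ck_on 1 U V ->
  exists2 h, 0 < h & exists2 x : R -> 'rV[R]_n, x 0 = x0 &
    forall t, `|t| < h -> U (x t) /\ is_derive t (1 : R) x (V (x t)).
Proof.
move=> oU Ux0 CV.
have [r r0 [L L0 [rU VL]]] := C1_locally_lipschitz oU Ux0 CV.
pose box (y : 'rV[R]_n) : 'rV[R]_n :=
  \row_i clamp (x0 0 i - r) (x0 0 i + r) (y 0 i).
have box_in y : `|x0 - box y| <= r.
  apply/mx_norm_leP => [|i j]; first exact: ltW.
  rewrite (ord1 i) !mxE ler_norml.
  have rr : x0 0 j - r <= x0 0 j + r by lra.
  by have /andP[] := clamp_in (y 0 j) rr; lra.
have box_id y : `|x0 - y| <= r -> box y = y.
  move=> /(mx_norm_leP _ (ltW r0)) yr; apply/rowP => j; rewrite mxE.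
  by apply: clamp_id; have := yr 0 j; rewrite !mxE ler_norml; lra.
have box_lip y z : `|box y - box z| <= `|y - z|.
  apply/mx_norm_leP => [//|i j]; rewrite (ord1 i) !mxE.
  apply: le_trans (clamp_lipschitz _ _ _ _) _.
  have /(mx_norm_leP _ (normr_ge0 _)) /(_ 0 j) := lexx `|y - z|.
  by rewrite !mxE.
have WL y z : `|(V \o box) y - (V \o box) z| <= L * `|y - z|.
  by rewrite (le_trans (VL _ _ (box_in y) (box_in z))) // ler_wpM2l.
have [h h0 [x x_0 dx]] := picard_lipschitz x0 L0 WL.
have [e e0 xe] : exists2 e, 0 < e & forall t, `|t| < e -> `|x0 - x t| <= r.
  have xc : {for 0, continuous x}.
    apply/differentiable_continuous/derivable1_diffP.
    by have := dx 0; rewrite normr0 => /(_ h0) ?; exact: ex_derive.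
  have /nbhs_ballP [e /= e0 He] : \forall t \near (0 : R), `|x0 - x t| <= r.
    by move/cvgrPdist_le : xc => /(_ _ r0); rewrite x_0.
  by exists e => // t te; apply: He; rewrite -ball_normE /= sub0r normrN.
exists (Num.min h e); first by rewrite lt_min h0.
exists x => // t; rewrite lt_min => /andP[/dx dxt /xe xt].
by split; [exact: rU|move: dxt; rewrite /= box_id].
Qed.

End LocalSolutions.

(** * The Lie algebra and its integral curves *)

Section VectorFieldAlgebra.
Context {R : realType} {n : nat} {G : lieGroupType R n}.
Implicit Types (f : G -> R) (p g h : G) (c d : chart R n G) (X Y : vfield G).

Lemma lie_algebra0 : lie_algebra (0 : vfield G).
Proof.
split=> [c ac|h p f _ //]; exists (cst 0).
  by move=> k; apply: Ck_on_cst; exact: chart_img_open.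
by move=> f p cp sf; rewrite derive0.
Qed.

Lemma lie_algebraD X Y : lie_algebra X -> lie_algebra Y -> lie_algebra (X + Y).
Proof.
move=> [vX rX] [vY rY]; split=> [c ac|h p f sf]; last first.
  by rewrite !fctE rX // rY.
have [a sa Xa] := vX c ac; have [b sb Yb] := vY c ac.
exists (fun x => a x + b x).
  by move=> k; apply: Ck_onD; [exact: chart_img_open|exact: sa|exact: sb].
move=> f p cp sf; have df := smooth_near_differentiable (sf c ac cp).
rewrite [LHS](_ : _ = X f p + Y f p) // (Xa f p cp sf) (Yb f p cp sf).
by rewrite (deriveE (a _) df) (deriveE (b _) df) (deriveE _ df) linearD.
Qed.

Lemma lie_algebraZ (k : R) X : lie_algebra X -> lie_algebra (k *: X).
Proof.
move=> [vX rX]; split=> [c ac|h p f sf]; last by rewrite !fctE rX.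
have [a sa Xa] := vX c ac; exists (fun x => k *: a x).
  by move=> i; apply: Ck_onZ; [exact: chart_img_open|exact: sa].
move=> f p cp sf; have df := smooth_near_differentiable (sf c ac cp).
rewrite [LHS](_ : _ = k *: X f p) // (Xa f p cp sf) (deriveE (a _) df).
by rewrite (deriveE _ df) linearZ.
Qed.

Lemma lie_algebra_sum (I : Type) (r : seq I) (X : I -> vfield G) :
  (forall i, lie_algebra (X i)) -> lie_algebra (\sum_(i <- r) X i).
Proof.
by move=> lX; apply: big_ind => // *; [exact: lie_algebra0|exact: lie_algebraD].
Qed.

Lemma dID X Y : dI (X + Y) = dI X + dI Y. Proof. by []. Qed.

Lemma dIZ (k : R) X : dI (k *: X) = k *: dI X. Proof. by []. Qed.

Lemma dI0 : dI (0 : vfield G) = 0. Proof. by []. Qed.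

Lemma dI_sum (I : Type) (r : seq I) (X : I -> vfield G) :
  dI (\sum_(i <- r) X i) = \sum_(i <- r) dI (X i).
Proof. by apply: big_morph; [exact: dID|exact: dI0]. Qed.

End VectorFieldAlgebra.

Section IntegralCurves.
Context {R : realType} {n : nat} {G : lieGroupType R n}.
Implicit Types (f : G -> R) (p g h : G) (c d : chart R n G).
Implicit Types (X Y A B C : vfield G) (J : set R) (gam del : R -> G) (a b r t : R).

Lemma integral_curve_sub J J' X gam :
  J' `<=` J -> integral_curve_on J X gam -> integral_curve_on J' X gam.
Proof. by move=> sJ Xg t /sJ; exact: Xg. Qed.

Lemma integral_curve_vf_eq J X Y gam : vf_eq X Y ->
  integral_curve_on J X gam -> integral_curve_on J Y gam.
Proof.
move=> XY Xg t /Xg [cg dg]; split=> // f sf.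
by rewrite -XY //; exact: dg.
Qed.

Lemma integral_curve_near X gam del t : (\forall s \near t, gam s = del s) ->
  integral_curve_on [set t] X gam -> integral_curve_on [set t] X del.
Proof.
move=> gd Xg _ ->; have [cg dg] := Xg t erefl; have gdt := nbhs_singleton gd.
split=> [|f]; last rewrite -gdt.
  rewrite /prop_for /continuous_at -gdt; apply: cvg_trans cg.
  by apply: near_eq_cvg; apply: filterS gd => s ->.
move=> /dg; apply: near_eq_is_derive.
by apply: filterS gd => s /= ->.
Qed.

Lemma integral_curve_affine J X gam (k a : R) : integral_curve_on J X gam ->
  integral_curve_on [set s | J (k * s + a)] (k *: X) (fun s => gam (k * s + a)).
Proof.
move=> Xg t /= Jt; have [cg dg] := Xg _ Jt.
have dl : is_derive t (1 : R) (fun s => k * s + a) k.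
  have := is_deriveD (is_deriveZ k (is_derive_id t (1 : R))) (is_derive_cst a t 1).
  by rewrite addr0 /GRing.scale /= mulr1.
split=> [|f sf].
  apply: (continuous_comp (f := fun s => k * s + a) (g := gam)) => //.
  by apply/differentiable_continuous/derivable1_diffP; exact: ex_derive.
have df := dg f sf.
have := @is_derive1_comp _ (f \o gam) (fun s => k * s + a) t _ _ df dl.
by rewrite mulrC.
Qed.

Lemma integral_curve_mulr J A gam h : lie_algebra A ->
  integral_curve_on J A gam -> integral_curve_on J A (fun t => (gam t * h)%g).
Proof.
move=> [_ rA] Ag t Jt; have [cg dg] := Ag t Jt; split=> [|f sf].
  apply: (continuous_comp (f := gam) (g := fun x => (x * h)%g)) => //.
  exact: (smooth_map_mulr h).1.
rewrite -rA //; apply: (dg (f \o (fun x => (x * h)%g))).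
exact: smooth_at_comp (smooth_map_mulr h) sf.
Qed.

Lemma integral_curve_inv J X gam :
  integral_curve_on J X gam -> integral_curve_on J (dI X) (fun t => (gam t)^-1%g).
Proof.
move=> Xg t Jt; have [cg dg] := Xg t Jt; split=> [|f sf].
  apply: (continuous_comp (f := gam) (g := fun x : G => x^-1%g)) => //.
  exact: lie_inv_continuous.
rewrite /dI invgK; apply: (dg (f \o (fun x => x^-1%g))).
exact: smooth_at_comp smooth_map_inv sf.
Qed.

(** Existence near time 0 is a statement about vector fields on R^n, read in a
    chart around the identity. *)
Lemma local_integral_curve A : lie_algebra A ->
  exists2 r, 0 < r & exists2 gam : R -> G,
    gam 0 = 1%g & integral_curve_on `]- r, r[ A gam.
Proof.
move=> [vA _]; have [c ac c1] := atlas_cover (1%g : G).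
have [a sa Aa] := vA c ac.
have [r r0 [x x0 dx]] :=
  picard_local (@chart_img_open _ _ _ c) (chart_map_img c1) (sa 1%N).
exists r => //; exists (chart_inv c \o x); first by rewrite /= x0 chart_mapK.
move=> t; rewrite /= in_itv /= -ltr_norml => /dx [cx dxt].
have xc : {for t, continuous x}.
  by apply/differentiable_continuous/derivable1_diffP; exact: ex_derive.
have gc : {for t, continuous (chart_inv c \o x)}.
  exact: continuous_comp xc (chart_inv_continuous cx).
split=> // f sf.
have cg : chart_dom c ((chart_inv c \o x) t) by exact: (chart_inv_dom cx).
have dg : is_derive t (1 : R) (chart_map c \o (chart_inv c \o x)) (a (x t)).
  apply: near_eq_is_derive dxt.
  have : \forall s \near t, chart_img c (x s).
    by apply: xc; apply: open_nbhs_nbhs; split=> //; exact: chart_img_open.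
  by apply: filterS => s cs; rewrite /= chart_invK.
have := is_derive_chart_curve cg gc dg ac sf.
by rewrite Aa //= chart_invK.
Qed.

(** Since x * x^-1 is constant, the differential of the inversion at the
    identity is - id. *)
Lemma lie_algebra_inv1 B f : lie_algebra B -> smooth_at f 1%g ->
  B f 1%g + B (fun x => f x^-1%g) 1%g = 0.
Proof.
move=> lB sf; have [r r0 [gam g0 Bg]] := local_integral_curve lB.
have J0 : `]- r, r[%classic (0 : R) by rewrite /= in_itv /=; lra.
have [dg Dg] := (integral_curve_onP _ _ _).1 Bg 0 J0.
have [dh Dh] := (integral_curve_onP _ _ _).1 (integral_curve_inv Bg) 0 J0.
have := @derive_mul_curve _ _ _ gam (fun s => (gam s)^-1%g) 0 f dg dh.
rewrite g0 invg1 mulg1 => /(_ sf) D.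
have : 'D_1 (fun s => f (gam s * (gam s)^-1)%g) (0 : R) = 0.
  rewrite (_ : (fun s => _) = cst (f 1%g)) ?derive_cst //.
  by apply/funext => s; rewrite mulgV.
rewrite (@derive_val _ _ _ _ _ _ _ D).
rewrite (_ : (fun s => f (gam s * 1)%g) = f \o gam); last first.
  by apply/funext => s; rewrite mulg1.
rewrite (_ : (fun s => f (1 * (gam s)^-1)%g) = f \o (fun s => (gam s)^-1%g));
  last by apply/funext => s; rewrite mul1g.
by rewrite Dg ?Dh g0 /dI ?invg1.
Qed.

(** Fields A + dI B with A, B right invariant behave like arrows from B to A:
    along a product of curves, the inner contributions dI B and B meet with
    opposite signs and cancel. *)
Lemma integral_curve_mul J A B C gam del :
  lie_algebra A -> lie_algebra B -> lie_algebra C ->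
  integral_curve_on J (A + dI B) gam -> integral_curve_on J (B + dI C) del ->
  integral_curve_on J (A + dI C) (fun t => (gam t * del t)%g).
Proof.
move=> [_ rA] lB [_ rC] /integral_curve_onP Xg /integral_curve_onP Xd.
have [_ rB] := lB.
apply/integral_curve_onP => t Jt.
have [dg Dg] := Xg t Jt; have [dd Dd] := Xd t Jt.
split=> [|f sf]; first exact: curve_differentiable_mul.
set p := gam t in Dg sf *; set q := del t in Dd sf *.
have D := derive_mul_curve dg dd sf; rewrite /comp (@derive_val _ _ _ _ _ _ _ D).
have sl : smooth_at (fun x => f (p * x)%g) q.
  exact: smooth_at_comp (smooth_map_mull p) sf.
have sr : smooth_at (fun x => f (x * q)%g) p.
  exact: smooth_at_comp (smooth_map_mulr q) sf.
have := Dg _ sr; rewrite /comp => ->; have := Dd _ sl; rewrite /comp => ->.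
rewrite !fctE rA //.
have -> : dI B (fun x => f (x * q)%g) p = B (fun x => f (p * x^-1 * q)%g) 1%g.
  rewrite /dI -[p^-1%g in LHS]mul1g -rB.
    by congr (B _ _); apply/funext => x; rewrite invgM invgK.
  rewrite mul1g.
  apply: (smooth_at_comp (smooth_map_inv (G := G)) (f := fun y => f (y * q)%g)).
  by rewrite invgK.
have -> : B (fun x => f (p * x)%g) q = B (fun x => f (p * x * q)%g) 1%g.
  rewrite -[q in LHS]mul1g -rB ?mul1g //.
  by congr (B _ _); apply/funext => x; rewrite mulgA.
have -> : dI C (fun x => f (p * x)%g) q = dI C f (p * q)%g.
  rewrite /dI invgM -rC.
    by congr (C _ _); apply/funext => x; rewrite invgM invgK.
  rewrite -invgM; apply: (smooth_at_comp (smooth_map_inv (G := G)) (f := f)).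
  by rewrite invgK.
have sk : smooth_at (fun x => f (p * x * q)%g) 1%g.
  apply: (smooth_at_comp (smooth_map_mull p) (f := fun y => f (y * q)%g)).
  by rewrite mulg1.
have := lie_algebra_inv1 lB sk; lra.
Qed.

End IntegralCurves.

(** * Uniqueness, completeness and the exponential *)

Section Uniqueness.
Context {R : realType} {n : nat} {G : lieGroupType R n}.
Implicit Types (A B : vfield G) (gam del alpha beta psi : R -> G) (a b r t : R).

Lemma itv_between a b s t u : a < s < b -> a < t < b ->
  Num.min s t <= u <= Num.max s t -> a < u < b.
Proof. by rewrite ge_min le_max => ? ? /andP[/orP[] ? /orP[] ?]; lra. Qed.

(** In a chart all coordinates of the curve have zero derivative. *)
Lemma zero_curve_locally_constant a b gam t : integral_curve_on `]a, b[ 0 gam ->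
  a < t < b -> \forall s \near t, a < s < b /\ gam s = gam t.
Proof.
move=> zg t_in; have [c ac ct] := atlas_cover (gam t).
have inP s : a < s < b -> `]a, b[%classic s by rewrite /= in_itv.
have /nbhs_ballP [e /= e0 He] :
    \forall s \near t, a < s < b /\ chart_dom c (gam s).
  apply: filterI.
    have : nbhs t `]a, b[%classic by apply: near_in_itvoo; rewrite in_itv.
    by apply: filterS => s; rewrite /= in_itv.
  by apply: (zg t (inP t t_in)).1; exact: near_chart_dom.
apply/nbhs_ballP; exists e => // s; rewrite -ball_normE /= => ts.
have He' u : Num.min s t <= u <= Num.max s t -> a < u < b /\ chart_dom c (gam u).
  move=> su; apply: He; rewrite -ball_normE /=.
  move: ts su; rewrite !ltr_norml ge_min le_max.
  by move=> ? /andP[/orP[] ? /orP[] ?]; lra.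
have sst : Num.min s t <= s <= Num.max s t by rewrite ge_min le_max lexx.
have [s_in cs] := He' s sst; split=> //.
rewrite -(chart_mapK cs) -(chart_mapK ct); congr (chart_inv c _).
apply/rowP => i; apply/eqP; rewrite eq_sym -subr_eq0 -normr_le0.
rewrite -(mul0r `|t - s|).
apply: (mean_value_le (f := fun u => chart_map c (gam u) 0 i) (f' := cst 0)).
  move=> u /He' [u_in cu].
  exact: (zg u (inP u u_in)).2 _ (smooth_at_chart_coord i ac cu).
by move=> u _; rewrite normr0.
Qed.

(** Constancy propagates from neighbourhoods to the interval: the indicator of
    the set where gam takes its value at s is locally constant, hence has zero
    derivative, hence is constant. *)
Lemma zero_curve_constant a b gam s t : integral_curve_on `]a, b[ 0 gam ->
  a < s < b -> a < t < b -> gam t = gam s.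
Proof.
move=> zg s_in t_in.
pose chi (u : R) : R := if `[< gam u = gam s >] then 1 else 0.
have dchi u : a < u < b -> is_derive u (1 : R) chi 0.
  move=> u_in; apply: near_eq_is_derive (is_derive_cst (chi u) u (1 : R)).
  apply: filterS (zero_curve_locally_constant zg u_in) => v [_ gv].
  by rewrite /chi gv.
have : `|chi t - chi s| <= 0 * `|t - s|.
  apply: (mean_value_le (f' := cst 0)) => u; last by rewrite normr0.
  by move=> /(itv_between s_in t_in) /dchi.
rewrite mul0r normr_le0 subr_eq0 => /eqP.
rewrite /chi [in RHS]asboolT //; case: asboolP => // _ /eqP.
by rewrite eq_sym oner_eq0.
Qed.

Lemma integral_curveD0 J A gam :
  integral_curve_on J A gam -> integral_curve_on J (A + dI 0) gam.
Proof. by apply: integral_curve_vf_eq => f p _; rewrite dI0 !fctE /= addr0. Qed.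

Lemma integral_curve0D J A gam :
  integral_curve_on J A gam -> integral_curve_on J (0 + A) gam.
Proof. by apply: integral_curve_vf_eq => f p _; rewrite !fctE /= add0r. Qed.

(** By the product rule gam^-1 * del follows the zero field. *)
Lemma right_invariant_curve_unique a b A gam del : lie_algebra A ->
  a < 0 -> 0 < b ->
  integral_curve_on `]a, b[ A gam -> integral_curve_on `]a, b[ A del ->
  gam 0 = del 0 -> forall t, a < t < b -> gam t = del t.
Proof.
move=> lA a0 b0 Ag Ad gd0 t t_in; have l0 := @lie_algebra0 R n G.
have := integral_curve_mul l0 lA l0
  (integral_curve0D (integral_curve_inv Ag)) (integral_curveD0 Ad).
move=> /(integral_curve_vf_eq (Y := 0)) zc.
have in0 : a < 0 < b by rewrite a0.
have := zero_curve_constant (zc _) in0 t_in.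
rewrite gd0 mulVg => /(_ _)/(congr1 (fun x => gam t * x)%g).
rewrite mulVKg mulg1 => -> // f p _.
by rewrite dI0 addr0.
Qed.

(** For fixed t, both sides are integral curves of A in s starting at gam t. *)
Lemma integral_curve_additive r A gam s t : lie_algebra A -> gam 0 = 1%g ->
  integral_curve_on `]- r, r[ A gam -> `|s| < r -> `|t| < r -> `|s + t| < r ->
  gam (s + t) = (gam s * gam t)%g.
Proof.
rewrite !ltr_norml => lA g0 Ag s_in t_in st_in.
(* The times s at which both sides are defined form the interval ]a, b[. *)
pose a := Num.max (- r) (- r - t); pose b := Num.min r (r - t).
have ab u : a < u < b -> - r < u < r /\ - r < u + t < r.
  by rewrite /a /b gt_max lt_min; lra.
apply: (@right_invariant_curve_unique a b A (fun u => gam (u + t))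
  (fun u => (gam u * gam t)%g)) => //.
- by rewrite /a gt_max; lra.
- by rewrite /b lt_min; lra.
- have := integral_curve_affine (k := 1) (a := t) Ag.
  rewrite scale1r (_ : (fun s => gam (1 * s + t)) = (fun s => gam (s + t))).
    by apply: integral_curve_sub => u; rewrite /= !in_itv /= mul1r => /ab [].
  by apply/funext => v; rewrite mul1r.
- apply: integral_curve_mulr => //; apply: integral_curve_sub Ag => u.
  by rewrite /= !in_itv /= => /ab [].
- by rewrite add0r g0 mul1g.
by rewrite /a /b gt_max lt_min; lra.
Qed.

(** alpha (t / 2) ^ 2 solves on the doubled interval: near t0 it is
    alpha (t - t0) times its own value at t0, because the values of alpha
    commute. *)
Lemma integral_curve_double r A gam : lie_algebra A -> 0 < r -> gam 0 = 1%g ->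
  integral_curve_on `]- r, r[ A gam ->
  integral_curve_on `]- (2 * r), 2 * r[ A
    (fun t => (gam (t / 2)%R * gam (t / 2)%R)%g).
Proof.
move=> lA r0 g0 Ag t; rewrite /= in_itv /= => t_in.
have t2 : `|t / 2| < r by rewrite ltr_norml; lra.
pose e := r - `|t / 2|; have e0 : 0 < e by rewrite subr_gt0.
have := integral_curve_affine (k := 1) (a := - t)
  (integral_curve_mulr (gam (t / 2)%R * gam (t / 2)%R)%g lA Ag).
rewrite scale1r => Agt; have tJ : `]- r, r[%classic (1 * t - t).
  by rewrite /= in_itv /= mul1r subrr; lra.
have At : integral_curve_on [set t] A
    (fun s => gam (1 * s - t)%R * (gam (t / 2)%R * gam (t / 2)%R))%g.
  by move=> _ ->; exact: Agt.
apply: (integral_curve_near _ At) => //.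
apply/nbhs_ballP; exists (Num.min e r); first by rewrite /= lt_min e0.
move=> s; rewrite -ball_normE /= lt_min => /andP[ts1 ts2].
(* Write s / 2 = d + t / 2, so that s - t = d + d; all the times met below
   lie in ]-r, r[. *)
pose d := (s - t) / 2.
have sE : s / 2 = d + t / 2 by rewrite /d; field.
have stE : 1 * s - t = d + d by rewrite /d; field.
have dE : `|d| * 2 = `|t - s|.
  by rewrite distrC /d normrM (ger0_norm (_ : 0 <= 2^-1)) // divfK.
have nd := normr_ge0 d; have nt := normr_ge0 (t / 2).
have d_r : `|d| < r by lra.
have dd_r : `|d + d| < r by rewrite (le_lt_trans (ler_normD _ _)) //; lra.
have dt_r : `|d + t / 2| < r.
  by rewrite (le_lt_trans (ler_normD _ _)) // -ltrBrDr; rewrite /e in ts1; lra.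
have add := integral_curve_additive lA g0 Ag.
rewrite stE sE (add d d) // (add d (t / 2)) // -!mulgA; congr (_ * _)%g.
rewrite !mulgA -(add d (t / 2)) // addrC add //.
by rewrite addrC.
Qed.

Lemma integral_curve_exists_on A T : lie_algebra A ->
  exists2 gam : R -> G, gam 0 = 1%g & integral_curve_on `]- T, T[ A gam.
Proof.
move=> lA; have [r r0 [gam0 g0 Ag]] := local_integral_curve lA.
have [k Tk] : exists k, T <= 2 ^+ k * r.
  have [N /(_ _ (leqnn _)) HN] := geometric_half_small `|T| r0; exists N.
  rewrite mulrC -ler_pdivrMr ?exprn_gt0 // -exprVn.
  by rewrite ltW // (le_lt_trans _ HN) // ler_wpM2r ?ler_norm // exprn_ge0.
have [gam ? Agk] : exists2 gam : R -> G, gam 0 = 1%g &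
    integral_curve_on `]- (2 ^+ k * r), 2 ^+ k * r[ A gam.
  elim: k {Tk} => [|k [gam gam_0 IH]].
    by exists gam0; rewrite // expr0 mul1r.
  exists (fun t => gam (t / 2)%R * gam (t / 2)%R)%g.
    by rewrite mul0r gam_0 mulg1.
  rewrite exprS -mulrA; apply: integral_curve_double => //.
  by rewrite mulr_gt0 // exprn_gt0.
exists gam => //; apply: integral_curve_sub Agk => t.
by rewrite /= !in_itv /=; lra.
Qed.

(** The solutions on the intervals ]-T, T[ agree by uniqueness, so the value at
    t can be read off from the one with T = |t| + 1. *)
Theorem integral_curve_exists A : lie_algebra A ->
  exists2 gam : R -> G, gam 0 = 1%g & integral_curve_on setT A gam.
Proof.
move=> lA.
have /choice [F HF] : forall T : R, exists gam : R -> G,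
    gam 0 = 1%g /\ integral_curve_on `]- T, T[ A gam.
  by move=> T; have [gam ? ?] := integral_curve_exists_on T lA; exists gam.
have FE T T' t : `|t| < T -> `|t| < T' -> F T t = F T' t.
  wlog TT' : T T' / T <= T' => [H tT tT'|tT tT'].
    by have [TT'|/ltW TT'] := leP T T'; [exact: H|exact/esym/H].
  have [F0 AF] := HF T; have [F0' AF'] := HF T'.
  have T0 : 0 < T by exact: le_lt_trans tT.
  apply: (@right_invariant_curve_unique (- T) T A) => //.
  - by rewrite oppr_lt0.
  - by apply: integral_curve_sub AF' => s; rewrite /= !in_itv /=; lra.
  - by rewrite F0 F0'.
  - by rewrite -ltr_norml.
exists (fun t => F (`|t| + 1) t); first exact: (HF _).1.
move=> t _; have [_ AF] := HF (`|t| + 1).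
have t1 : `|t| < `|t| + 1 by rewrite ltrDl.
have At : integral_curve_on [set t] A (F (`|t| + 1)).
  by apply: integral_curve_sub AF => _ ->; rewrite /= in_itv /= -ltr_norml.
apply: (integral_curve_near _ At) => //.
by apply: filterS (near_norm_lt t1) => s st; apply: FE => //; rewrite ltrDl.
Qed.

Lemma integral_curve_setT_unique A gam del : lie_algebra A ->
  integral_curve_on setT A gam -> integral_curve_on setT A del ->
  gam 0 = del 0 -> gam =1 del.
Proof.
move=> lA Ag Ad gd0 t; pose T := `|t| + 1.
have tT : `|t| < T by rewrite ltrDl.
apply: (@right_invariant_curve_unique (- T) T A) => //.
- by rewrite oppr_lt0 (le_lt_trans _ tT).
- by rewrite (le_lt_trans _ tT).
- exact: integral_curve_sub Ag.
- exact: integral_curve_sub Ad.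
- by rewrite -ltr_norml.
Qed.

(** s |-> gam (t s) is the integral curve of tA, and its value at s = 1 is
    gam t. *)
Lemma lie_expZ A gam t : lie_algebra A -> gam 0 = 1%g ->
  integral_curve_on setT A gam -> lie_exp (t *: A) = gam t.
Proof.
move=> lA g0 Ag.
have Agt : integral_curve_on setT (t *: A) (fun s => gam (t * s + 0)).
  by apply: integral_curve_sub (integral_curve_affine Ag) => s.
rewrite /lie_exp; apply: xget_unique.
  exists (fun s => gam (t * s + 0)); split=> //; first by rewrite mulr0 addr0.
  by rewrite mulr1 addr0.
move=> _ [del [Ad d0 <-]].
have -> : gam t = gam (t * 1 + 0) by rewrite mulr1 addr0.
apply: (integral_curve_setT_unique (lie_algebraZ t lA) Ad Agt).
by rewrite d0 mulr0 addr0.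
Qed.

(** With alpha and beta the integral curves of A and B, the composition rule
    gives existence as A + dI 0 followed by 0 + dI B, and uniqueness as 0 + dI A
    (for alpha^-1), A + dI B (for any solution) and B + dI 0, composed into the
    zero field. *)
Theorem affine_field_solution A B : lie_algebra A -> lie_algebra B ->
  is_the_solution (A + dI B) 1%g
    (fun t : R => lie_exp (t *: A) * lie_exp (- t *: B))%g.
Proof.
move=> lA lB; have l0 := @lie_algebra0 R n G.
have [alpha a0 Aa] := integral_curve_exists lA.
have [beta b0 Bb] := integral_curve_exists lB.
have betaV t : beta (- t) = (beta t)^-1%g.
  have bt : `|t| < `|t| + 1 by rewrite ltrDl.
  rewrite -[LHS](mulgK (beta t)) -[RHS]mul1g; congr (_ * _)%g.
  rewrite -b0 -[in RHS](addNr t); symmetry.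
  apply: (integral_curve_additive (r := `|t| + 1) lB b0) => //.
  - exact: integral_curve_sub Bb.
  - by rewrite normrN.
  - by rewrite addNr normr0 (le_lt_trans _ bt).
have phiE t : (lie_exp (t *: A) * lie_exp (- t *: B) = alpha t * (beta t)^-1)%g.
  by rewrite (lie_expZ _ lA a0 Aa) (lie_expZ _ lB b0 Bb) betaV.
split.
- by rewrite phiE a0 b0 invg1 mulg1.
- rewrite (_ : (fun t => _) = (fun t => alpha t * (beta t)^-1)%g).
    apply: (integral_curve_mul lA l0 lB); first exact: integral_curveD0.
    exact/integral_curve0D/integral_curve_inv.
  exact/funext.
- move=> a b psi a_lt0 b_gt0 psi0 Xpsi t; rewrite phiE in_itv /= => t_in.
  have Aa' : integral_curve_on `]a, b[ A alpha by exact: integral_curve_sub Aa.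
  have Bb' : integral_curve_on `]a, b[ B beta by exact: integral_curve_sub Bb.
  have z := integral_curve_mul l0 lB l0 (integral_curve_mul l0 lA lB
    (integral_curve0D (integral_curve_inv Aa')) Xpsi) (integral_curveD0 Bb').
  have {}z : integral_curve_on `]a, b[ 0
      (fun t => (alpha t)^-1 * psi t * beta t)%g.
    by apply: integral_curve_vf_eq z => f p _; rewrite dI0 addr0.
  have in0 : a < 0 < b by rewrite a_lt0.
  have := zero_curve_constant z in0 t_in.
  rewrite psi0 a0 b0 invg1 !mulg1 => zt.
  rewrite -[psi t](mulVKg (alpha t)) -[(_^-1 * psi t)%g](mulgK (beta t)) zt.
  by rewrite mul1g.
Qed.

End Uniqueness.

(** * The affine system *)

Section VectorFieldCongruence.
Context {R : realType} {n : nat} {G : lieGroupType R n}.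
Implicit Types X Y : vfield G.

Lemma vf_eqD X X' Y Y' : vf_eq X X' -> vf_eq Y Y' -> vf_eq (X + Y) (X' + Y').
Proof. by move=> XX YY f p sf; rewrite !fctE /= XX // YY. Qed.

Lemma vf_eqZ (k : R) X X' : vf_eq X X' -> vf_eq (k *: X) (k *: X').
Proof. by move=> XX f p sf; rewrite !fctE /= XX. Qed.

Lemma vf_eq_sum (I : Type) (r : seq I) (X X' : I -> vfield G) :
  (forall i, vf_eq (X i) (X' i)) ->
  vf_eq (\sum_(i <- r) X i) (\sum_(i <- r) X' i).
Proof.
move=> XX; apply: (big_ind2 (R1 := vfield G) (R2 := vfield G)
  (fun X X' => vf_eq X X')) => //.
exact: vf_eqD.
Qed.

Lemma is_the_solution_vf_eq X Y g phi :
  vf_eq X Y -> is_the_solution Y g phi -> is_the_solution X g phi.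
Proof.
move=> XY [phi0 Yphi uniq]; have YX : vf_eq Y X by move=> f p /XY.
split=> // [|a b psi a0 b0 psi0 Xpsi]; first exact: integral_curve_vf_eq Yphi.
by apply: uniq => //; exact: integral_curve_vf_eq Xpsi.
Qed.

End VectorFieldCongruence.

Unset Implicit Arguments.

Theorem theorem3p1 (R : realType) (n : nat) (G : lieGroupType R n)
    (G_connected : connected [set: G]) (m : nat)
    (calX X Y : 'I_m.+1 -> vfield G) (u : 'I_m.+1 -> R)
    (calX_linear : forall i, linear_vf (calX i))
    (calX_commute : forall i j, vf_eq (bracket (calX i) (calX j)) 0)
    (calX_inner : forall i, inner_derivation (derivation_of (calX i)))
    (X_in_g : forall i, lie_algebra (X i))
    (calX_eq : forall i, vf_eq (calX i) (X i + dI (X i)))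
    (Y_in_g : forall i, lie_algebra (Y i))
    (u0 : u ord0 = 1) :
  is_the_solution
    (calX ord0 + Y ord0 +
      \sum_(j < m) u (lift ord0 j) *: (calX (lift ord0 j) + Y (lift ord0 j)))
    1%g
    (fun t : R =>
      (lie_exp (t *: X ord0 + t *: Y ord0 +
         \sum_(j < m) (u (lift ord0 j) * t) *:
           (X (lift ord0 j) + Y (lift ord0 j)))
       * lie_exp (- t *: \sum_(i < m.+1) u i *: X i))%g).
Proof.
pose A : vfield G := X ord0 + Y ord0 +
  \sum_(j < m) u (lift ord0 j) *: (X (lift ord0 j) + Y (lift ord0 j)).
pose B : vfield G := \sum_(i < m.+1) u i *: X i.
have lA : lie_algebra A.
  apply: lie_algebraD; first exact: lie_algebraD.
  by apply: lie_algebra_sum => j; apply: lie_algebraZ; exact: lie_algebraD.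
have lB : lie_algebra B.
  by apply: lie_algebra_sum => i; exact: lie_algebraZ.
have expA t : t *: X ord0 + t *: Y ord0 +
    \sum_(j < m) (u (lift ord0 j) * t) *:
      (X (lift ord0 j) + Y (lift ord0 j)) = t *: A.
  rewrite /A !scalerDr scaler_sumr; congr (_ + _).
  by apply: eq_bigr => j _; rewrite scalerA mulrC.
rewrite (_ : (fun t : R => _) =
    fun t : R => (lie_exp (t *: A) * lie_exp (- t *: B))%g); last first.
  by apply/funext => t; rewrite -expA.
apply: is_the_solution_vf_eq (affine_field_solution lA lB).
have -> : A + dI B = (X ord0 + dI (X ord0)) + Y ord0 +
    \sum_(j < m) u (lift ord0 j) *:
      ((X (lift ord0 j) + dI (X (lift ord0 j))) + Y (lift ord0 j)).
  rewrite dI_sum big_ord_recl u0 scale1r /A.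
  rewrite [in RHS](addrAC (X ord0)) -!addrA; congr (_ + (_ + _)).
  rewrite addrCA; congr (_ + _); rewrite -big_split /=.
  by apply: eq_bigr => j _; rewrite dIZ addrAC -scalerDr.
apply: vf_eqD; first by apply: vf_eqD.
by apply: vf_eq_sum => j; apply: vf_eqZ; exact: vf_eqD.
Qed.
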